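(* Let $P$ be a Boolean ring with $P=A\oplus B$ for some non-principal ideals $A$ and $B$ of $P$. Then the truss $\mathrm{B}(A,B)$ is isomorphic neither to $\mathrm{T}(P)$ nor to $\mathrm{T}(P,\circ)$.
   Context: An Abelian heap is a set $H$ with a ternary operation $[-,-,-]$ such that for all $a_1,\dots,a_5\in H$: $[[a_1,a_2,a_3],a_4,a_5]=[a_1,a_2,[a_3,a_4,a_5]]$; $[a_1,a_2,a_2]=a_1$ and $[a_2,a_1,a_1]=a_2$; $[a_1,a_2,a_3]=[a_3,a_2,a_1]$. A truss is an Abelian heap $(T,[-,-,-])$ with an associative binary operation $\cdot$ satisfying $a\cdot[b,c,d]=[a\cdot b,a\cdot c,a\cdot d]$ and $[b,c,d]\cdot a=[b\cdot a,c\cdot a,d\cdot a]$. A truss isomorphism is a bijection preserving both operations; direct products carry componentwise operations. Rings are associative and need not be unital; a Boolean ring is a (not necessarily unital) ring in which $x^2=x$ for all $x$. $P=A\oplus B$ means that $P$ is the internal direct sum of the ideals $A$ and $B$. For a ring $R$, $\mathrm{T}(R)$ is the set $R$ with heap operation $[a,b,c]=a-b+c$ and the ring multiplication, and $\mathrm{T}(R,\circ)$ is the set $R$ with the same heap operation and multiplication $a\circ b=a+b+ab$. For ideals $A,B$ of $P$ with $P=A\oplus B$ (regarded as rings), $\mathrm{B}(A,B):=\mathrm{T}(A,\circ)\times \mathrm{T}(B)$. *)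

(* Defs.v *)
From HB Require Import structures.
From mathcomp Require Import all_boot all_order all_algebra.
From mathcomp Require Import boolp classical_sets.

Set Implicit Arguments.
Unset Strict Implicit.
Unset Printing Implicit Defensive.

Import GRing.Theory.
Local Open Scope classical_set_scope.
Local Open Scope ring_scope.

(* Associative, not necessarily unital rings. The multiplication is that of
   the underlying [semigroupType], hence written [(x * y)%g]. *)
HB.mixin Record isNonunitalRing R of GRing.Zmodule R & Semigroup R := {
  nmulDl : forall x y z : R, ((x + y)%R * z)%g = (x * z)%g + (y * z)%g;
  nmulDr : forall x y z : R, (x * (y + z)%R)%g = (x * y)%g + (x * z)%g
}.

#[short(type="nonunitalRingType")]
HB.structure Definition NonunitalRing :=
  {R of isNonunitalRing R & GRing.Zmodule R & Semigroup R}.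

Section NonunitalRingTheory.
Variable R : nonunitalRingType.
Implicit Types x y z : R.

Lemma nmul0r x : (0%R * x)%g = 0 :> R.
Proof. by apply: (@addrI _ (0%R * x)%g); rewrite -nmulDl !addr0. Qed.

Lemma nmulr0 x : (x * 0%R)%g = 0 :> R.
Proof. by apply: (@addrI _ (x * 0%R)%g); rewrite -nmulDr !addr0. Qed.

Lemma nmulNr x y : ((- x)%R * y)%g = - (x * y)%g.
Proof. by apply: (@addrI _ (x * y)%g); rewrite -nmulDl !subrr nmul0r. Qed.

Lemma nmulrN x y : (x * (- y)%R)%g = - (x * y)%g.
Proof. by apply: (@addrI _ (x * y)%g); rewrite -nmulDr !subrr nmulr0. Qed.

End NonunitalRingTheory.

Definition boolean_ring (R : nonunitalRingType) : Prop :=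
  forall x : R, (x * x)%g = x.

Definition is_ideal (R : nonunitalRingType) (I : set R) : Prop :=
  [/\ I 0,
      forall x y, I x -> I y -> I (x - y),
      forall r x, I x -> I (r * x)%g &
      forall r x, I x -> I (x * r)%g].

Record ideal (R : nonunitalRingType) := Ideal {
  ideal_set :> set R;
  idealP : is_ideal ideal_set
}.

(* Without a unit, the ideal generated by [a] is not [aR] in general. *)
Definition principal (R : nonunitalRingType) (I : ideal R) : Prop :=
  exists a : R, I = smallest (@is_ideal R) [set a] :> set R.

Definition direct_sum (R : nonunitalRingType) (A B : ideal R) : Prop :=
  [set a + b | a in A & b in B] = [set: R] /\ A `&` B = [set 0].

Definition ideal_ring (R : nonunitalRingType) (I : ideal R) : Type :=
  set_type I.

Section IdealRing.
Variables (R : nonunitalRingType) (I : ideal R).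

HB.instance Definition _ := SubChoice.on (ideal_ring I).

Let toI (x : R) (Ix : ideal_set I x) : ideal_ring I := SigSub (mem_set Ix).

Let memI (x : ideal_ring I) : ideal_set I (val x).
Proof. exact: set_mem (valP x). Qed.

Let I_opp (x : R) : ideal_set I x -> ideal_set I (- x).
Proof. by case: (idealP I) => I0 IB _ _ Ix; rewrite -sub0r; apply: IB. Qed.

Let I_add (x y : R) : ideal_set I x -> ideal_set I y -> ideal_set I (x + y).
Proof.
by case: (idealP I) => _ IB _ _ Ix /I_opp Iy; rewrite -[y]opprK; apply: IB.
Qed.

Let I_mul (x y : R) : ideal_set I x -> ideal_set I y -> ideal_set I (x * y)%g.
Proof. by case: (idealP I) => _ _ IM _ _ Iy; apply: IM. Qed.

Let I_zero : ideal_set I 0.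
Proof. by case: (idealP I). Qed.

Definition ideal_ring_zero : ideal_ring I := toI I_zero.
Definition ideal_ring_opp (x : ideal_ring I) : ideal_ring I :=
  toI (I_opp (memI x)).
Definition ideal_ring_add (x y : ideal_ring I) : ideal_ring I :=
  toI (I_add (memI x) (memI y)).
Definition ideal_ring_mul (x y : ideal_ring I) : ideal_ring I :=
  toI (I_mul (memI x) (memI y)).

Let addA : associative ideal_ring_add.
Proof. by move=> x y z; apply: val_inj; apply: addrA. Qed.
Let addC : commutative ideal_ring_add.
Proof. by move=> x y; apply: val_inj; apply: addrC. Qed.
Let add0 : left_id ideal_ring_zero ideal_ring_add.
Proof. by move=> x; apply: val_inj; apply: add0r. Qed.
Let addN : left_inverse ideal_ring_zero ideal_ring_opp ideal_ring_add.
Proof. by move=> x; apply: val_inj; apply: addNr. Qed.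
Let mulA : associative ideal_ring_mul.
Proof. by move=> x y z; apply: val_inj; apply: mulgA. Qed.

HB.instance Definition _ :=
  GRing.isZmodule.Build (ideal_ring I) addA addC add0 addN.
HB.instance Definition _ := isSemigroup.Build (ideal_ring I) mulA.

Let mulDl (x y z : ideal_ring I) :
  ((x + y)%R * z)%g = (x * z)%g + (y * z)%g.
Proof. by apply: val_inj; apply: nmulDl. Qed.
Let mulDr (x y z : ideal_ring I) :
  (x * (y + z)%R)%g = (x * y)%g + (x * z)%g.
Proof. by apply: val_inj; apply: nmulDr. Qed.

HB.instance Definition _ := isNonunitalRing.Build (ideal_ring I) mulDl mulDr.

End IdealRing.

HB.mixin Record isAbelianHeap H := {
  heap : H -> H -> H -> H;
  heapA : forall a b c d e : H,
    heap (heap a b c) d e = heap a b (heap c d e);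
  heapKr : forall a b : H, heap a b b = a;
  heapKl : forall a b : H, heap b b a = a;
  heapC : forall a b c : H, heap a b c = heap c b a
}.

#[short(type="abelianHeapType")]
HB.structure Definition AbelianHeap := {H of isAbelianHeap H}.

HB.mixin Record isTruss T of AbelianHeap T & Semigroup T := {
  mul_heapr : forall a b c d : T,
    (a * heap b c d)%g = heap (a * b)%g (a * c)%g (a * d)%g;
  mul_heapl : forall a b c d : T,
    (heap b c d * a)%g = heap (b * a)%g (c * a)%g (d * a)%g
}.

#[short(type="trussType")]
HB.structure Definition Truss :=
  {T of isTruss T & AbelianHeap T & Semigroup T}.

Definition truss_isomorphism (S T : trussType) (f : S -> T) : Prop :=
  [/\ bijective f,
      forall a b c, f (heap a b c) = heap (f a) (f b) (f c) &
      forall a b, f (a * b)%g = (f a * f b)%g].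

Definition truss_isomorphic (S T : trussType) : Prop :=
  exists f : S -> T, truss_isomorphism f.

(* The binary product of semigroups is the library's; its multiplication is
   componentwise. *)
Section ProductTruss.
Variables S T : trussType.

Definition prod_heap (a b c : S * T) : S * T :=
  (heap a.1 b.1 c.1, heap a.2 b.2 c.2).

Let hA a b c d e :
  prod_heap (prod_heap a b c) d e = prod_heap a b (prod_heap c d e).
Proof. by rewrite /prod_heap /= !heapA. Qed.
Let hKr a b : prod_heap a b b = a.
Proof. by case: a => a1 a2; rewrite /prod_heap /= !heapKr. Qed.
Let hKl a b : prod_heap b b a = a.
Proof. by case: a => a1 a2; rewrite /prod_heap /= !heapKl. Qed.
Let hC a b c : prod_heap a b c = prod_heap c b a.
Proof. by rewrite /prod_heap heapC (heapC a.2). Qed.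

HB.instance Definition _ := isAbelianHeap.Build (S * T)%type hA hKr hKl hC.

Let hMr (a b c d : S * T) :
  (a * heap b c d)%g = heap (a * b)%g (a * c)%g (a * d)%g.
Proof. by congr pair; apply: mul_heapr. Qed.
Let hMl (a b c d : S * T) :
  (heap b c d * a)%g = heap (b * a)%g (c * a)%g (d * a)%g.
Proof. by congr pair; apply: mul_heapl. Qed.

HB.instance Definition _ := isTruss.Build (S * T)%type hMr hMl.

End ProductTruss.

Section RingHeap.
Variable R : zmodType.

Definition ring_heap (a b c : R) : R := a - b + c.

Lemma ring_heapA a b c d e :
  ring_heap (ring_heap a b c) d e = ring_heap a b (ring_heap c d e).
Proof. by rewrite /ring_heap !addrA. Qed.
Lemma ring_heapKr a b : ring_heap a b b = a.
Proof. by rewrite /ring_heap subrK. Qed.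
Lemma ring_heapKl a b : ring_heap b b a = a.
Proof. by rewrite /ring_heap subrr add0r. Qed.
Lemma ring_heapC a b c : ring_heap a b c = ring_heap c b a.
Proof. by rewrite /ring_heap addrC addrCA addrA addrAC [in RHS]addrAC addrC addrA. Qed.

End RingHeap.

(* [ring_truss R] is T(R) and [circ_truss R] is T(R, o): two aliases of the
   carrier of [R], carrying different multiplications. *)
Definition ring_truss (R : nonunitalRingType) : Type := R.
Definition circ_truss (R : nonunitalRingType) : Type := R.

Section RingTruss.
Variable R : nonunitalRingType.

HB.instance Definition _ := Semigroup.copy (ring_truss R) R.
HB.instance Definition _ := isAbelianHeap.Build (ring_truss R)
  (@ring_heapA R) (@ring_heapKr R) (@ring_heapKl R) (@ring_heapC R).

Let hMr (a b c d : ring_truss R) :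
  (a * heap b c d)%g = heap (a * b)%g (a * c)%g (a * d)%g.
Proof.
rewrite /heap /= /ring_heap.
by rewrite [LHS](@nmulDr R) (@nmulDr R) (@nmulrN R).
Qed.
Let hMl (a b c d : ring_truss R) :
  (heap b c d * a)%g = heap (b * a)%g (c * a)%g (d * a)%g.
Proof.
rewrite /heap /= /ring_heap.
by rewrite [LHS](@nmulDl R) (@nmulDl R) (@nmulNr R).
Qed.

HB.instance Definition _ := isTruss.Build (ring_truss R) hMr hMl.

End RingTruss.

Section CircTruss.
Variable R : nonunitalRingType.

Definition circ (a b : R) : R := a + b + (a * b)%g.

Lemma circA : associative circ.
Proof.
move=> a b c; rewrite /circ !nmulDl !nmulDr mulgA !addrA.
congr (_ + _).
rewrite -!addrA; congr (a + (b + _)).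
by rewrite [RHS]addrCA; congr (c + _); rewrite [RHS]addrA addrC.
Qed.

HB.instance Definition _ := Choice.copy (circ_truss R) R.
HB.instance Definition _ := isSemigroup.Build (circ_truss R) circA.
HB.instance Definition _ := isAbelianHeap.Build (circ_truss R)
  (@ring_heapA R) (@ring_heapKr R) (@ring_heapKl R) (@ring_heapC R).

Let heapDl (a b c d : R) :
  a + ring_heap b c d = ring_heap (a + b) (a + c) (a + d).
Proof. by rewrite /ring_heap opprD (addrACA a b) subrr add0r [RHS]addrCA. Qed.
Let heapD (a b c a' b' c' : R) :
  ring_heap a b c + ring_heap a' b' c' = ring_heap (a + a') (b + b') (c + c').
Proof. by rewrite /ring_heap opprD (addrACA a a') [RHS]addrACA. Qed.

Let hMr (a b c d : circ_truss R) :
  (a * heap b c d)%g = heap (a * b)%g (a * c)%g (a * d)%g.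
Proof.
change (circ a (ring_heap b c d)
  = ring_heap (circ a b) (circ a c) (circ a d)).
rewrite /circ -!(addrA a) -heapDl -heapD; congr (a + (_ + _)).
exact: (@mul_heapr (ring_truss R)).
Qed.

Let hMl (a b c d : circ_truss R) :
  (heap b c d * a)%g = heap (b * a)%g (c * a)%g (d * a)%g.
Proof.
change (circ (ring_heap b c d) a
  = ring_heap (circ b a) (circ c a) (circ d a)).
rewrite /circ ![_ + a]addrC -!(addrA a) -heapDl -heapD; congr (a + (_ + _)).
exact: (@mul_heapl (ring_truss R)).
Qed.

HB.instance Definition _ := isTruss.Build (circ_truss R) hMr hMl.

End CircTruss.

Definition trussB (R : nonunitalRingType) (A B : ideal R) : trussType :=
  (circ_truss (ideal_ring A) * ring_truss (ideal_ring B))%type.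

(* Main.v *)
Require Import Defs.
From mathcomp Require Import all_boot all_algebra.
From mathcomp Require Import boolp classical_sets.

Import GRing.Theory.
Local Open Scope classical_set_scope.
Local Open Scope ring_scope.

(** Two multiplicative properties separate the trusses.  In T(P) the element 0
    is absorbing, while in T(P,o) the element 0 is neutral, and both properties
    transfer along an isomorphism to T(A,o) x T(B), hence to each factor.
    An absorbing element [e] of T(A,o) satisfies [a + e + a e = e], that is
    [a = (- a) e], for every [a] in [A]; a neutral element [u] of T(B) satisfies
    [b = b u] for every [b] in [B].  In either case the ideal consists of left
    multiples of one of its own elements, so it is principal
    ([principal_of_left_multiples]). *)

(** Over a ring without unit the ideal generated by [a] contains the left
    multiples of [a], but they need not exhaust it; requiring [a] to lie in [I]
    is what makes [I] the smallest ideal containing it. *)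
Lemma principal_of_left_multiples (R : nonunitalRingType) (I : ideal R)
    (a : ideal_ring I) :
  (forall x : ideal_ring I, exists r : ideal_ring I, x = (r * a)%g) ->
  principal I.
Proof.
move=> Ia; exists (val a); rewrite eqEsubset; split=> x.
  move=> Ix J [[_ _ Jmul _] aJ].
  have [r xE] := Ia (SigSub (mem_set Ix)).
  rewrite [x](congr1 val xE); exact/Jmul/aJ.
apply; split; first exact: idealP.
by move=> _ ->; apply: set_mem (valP a).
Qed.

Lemma circ_absorbingE (R : nonunitalRingType) (a e : R) :
  circ a e = e -> a = (- a * e)%g.
Proof.
move=> abs; rewrite nmulNr; apply/eqP; rewrite -addr_eq0; apply/eqP.
by apply: (@addIr _ e); rewrite add0r -[RHS]abs /circ addrAC.
Qed.

Lemma truss_iso_absorbing (S T : trussType) (z : T) :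
  truss_isomorphic S T -> (forall t : T, (t * z)%g = z) ->
  exists y : S, forall s : S, (s * y)%g = y.
Proof.
move=> [f [[g fK gK] _ fM]] zabs; exists (g z) => s.
by rewrite -[LHS]fK fM gK zabs.
Qed.

Lemma truss_iso_neutral (S T : trussType) (u : T) :
  truss_isomorphic S T -> (forall t : T, (t * u)%g = t) ->
  exists v : S, forall s : S, (s * v)%g = s.
Proof.
move=> [f [[g fK gK] _ fM]] uneut; exists (g u) => s.
by rewrite -[LHS]fK fM gK uneut fK.
Qed.

Theorem corollary3p15 (P : nonunitalRingType) (A B : ideal P)
  (P_boolean : boolean_ring P) (P_sum : direct_sum A B)
  (A_nonprincipal : ~ principal A) (B_nonprincipal : ~ principal B) :
  ~ truss_isomorphic (trussB A B) (ring_truss P) /\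
  ~ truss_isomorphic (trussB A B) (circ_truss P).
Proof.
split=> iso.
- have [|[e b] abs] := truss_iso_absorbing _ (ring_truss P) (0%R : P) iso.
    exact: (@nmulr0 P).
  apply: A_nonprincipal; apply: (principal_of_left_multiples P A e) => a.
  by exists (- a); apply: circ_absorbingE; case: (abs (a, b)).
- have [|[a u] neut] := truss_iso_neutral _ (circ_truss P) (0%R : P) iso.
    move=> x; change (@circ P x 0 = x).
    by rewrite /circ nmulr0 !addr0.
  apply: B_nonprincipal; apply: (principal_of_left_multiples P B u) => b.
  by exists b; case: (neut (a, b)).
Qed.
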